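(* Let $\mathfrak{B}$ be a bornology on a topological space $X$. The following are equivalent. (1) $X$ satisfies $S_1(\Gamma_{\mathfrak{B}},\Gamma_{\mathfrak{B}})$. (2) ONE does not have a winning strategy in the game $G_1(\Gamma_{\mathfrak{B}},\Gamma_{\mathfrak{B}})$ on $X$.
   Context: A bornology $\mathfrak{B}$ on $X$ is a family of subsets of $X$ that is closed under taking subsets and finite unions and covers $X$; by standing convention $X\notin\mathfrak{B}$. $\Gamma_{\mathfrak{B}}$ is the collection of all $\gamma_{\mathfrak{B}}$-covers of $X$: infinite covers $\mathcal{U}=\{U_n:n\in\omega\}$ of $X$ by proper open subsets such that for each $B\in\mathfrak{B}$ there is $n_0\in\omega$ with $B\subseteq U_n$ for all $n\ge n_0$. $S_1(\mathcal{A},\mathcal{B})$ means that for each sequence $\{\mathcal{U}_n:n\in\omega\}$ of elements of $\mathcal{A}$ there are $V_n\in\mathcal{U}_n$ ($n\in\omega$) with $\{V_n:n\in\omega\}\in\mathcal{B}$. In the game $G_1(\mathcal{A},\mathcal{B})$ two players ONE and TWO play a round for each $n\in\omega$; in round $n$ ONE chooses $\mathcal{U}_n\in\mathcal{A}$ and TWO responds with some $V_n\in\mathcal{U}_n$. TWO wins the play if $\{V_n:n\in\omega\}\in\mathcal{B}$; otherwise ONE wins. *)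

(* Defs.v *)
From mathcomp Require Import all_boot.
From mathcomp Require Import all_classical topology.

Set Implicit Arguments.
Unset Strict Implicit.
Unset Printing Implicit Defensive.

Local Open Scope classical_set_scope.

(* The last clause is the standing convention that X itself is not bounded. *)
Definition bornology (X : Type) (B : set (set X)) : Prop :=
  [/\ forall A C : set X, A `<=` C -> B C -> B A,
      forall A C : set X, B A -> B C -> B (A `|` C),
      \bigcup_(A in B) A = setT
    & ~ B setT].

(* Covers are sets of open sets: the enumeration is existentially quantified
   and may have repetitions, but the family itself has to be infinite. *)
Definition gamma_covers (X : topologicalType) (B : set (set X)) :
    set (set (set X)) :=
  [set W | exists U : nat -> set X,
    [/\ W = range U,
        infinite_set W,
        cover setT U = setT,
        forall n, open (U n) /\ U n <> setT
      & forall A, B A -> exists n0 : nat, forall n, (n0 <= n)%N -> A `<=` U n]].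

Definition S1 (T : Type) (A C : set (set T)) : Prop :=
  forall U : nat -> set T, (forall n, A (U n)) ->
    exists V : nat -> T, (forall n, U n (V n)) /\ C (range V).

(* In the game G1(A, C), a strategy of ONE maps the finite sequence of TWO's
   previous moves to ONE's next move.  [legal_position sigma s]: the moves
   s_0, ..., s_(k-1) are legal answers of TWO when ONE follows sigma. *)
Definition legal_position (T : Type) (sigma : seq T -> set T) (s : seq T) :
    Prop :=
  forall (x0 : T) (i : nat), (i < size s)%N -> sigma (take i s) (nth x0 s i).

Definition strategy_ONE (T : Type) (A : set (set T)) (sigma : seq T -> set T) :
    Prop :=
  forall s : seq T, legal_position sigma s -> A (sigma s).

Definition winning_ONE (T : Type) (C : set (set T)) (sigma : seq T -> set T) :
    Prop :=
  forall V : nat -> T, (forall n, sigma (mkseq V n) (V n)) -> ~ C (range V).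

Definition ONE_has_winning_strategy_G1 (T : Type) (A C : set (set T)) : Prop :=
  exists sigma : seq T -> set T, strategy_ONE A sigma /\ winning_ONE C sigma.

(* Main.v *)
Require Import Defs.
From mathcomp Require Import all_boot.
From mathcomp Require Import all_classical topology.

(** Call a sequence [U] of proper open sets a gamma sequence when every bounded
    set lies in all but finitely many [U n]; a gamma cover is exactly the range
    of a gamma sequence ([gamma_coversP]), its infiniteness being automatic.

    If ONE has no winning strategy, then in particular no strategy that plays a
    given sequence of covers regardless of TWO's answers wins, and a play lost
    by ONE is the selection required by S1.

    The converse rests on a strengthening of S1 ([gamma_selection]): from a
    sequence of gamma sequences one can select terms that form a gamma sequence
    in the given order of rounds, rather than a family that is a gamma cover
    after some re-enumeration.  Now let [sigma] be a strategy of ONE.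
    Enumerating each of ONE's covers, the positions in which TWO has made
    finitely many choices are indexed by finite sequences of naturals.  These
    are countably many, so the selection principle applies to all positions
    simultaneously: it yields one answer [f t] at every position [t] such that
    each bounded set is contained in the answers at all but finitely many
    positions.  When TWO follows [f], the positions met during the play are
    pairwise distinct, so TWO's moves form a gamma sequence and the play is lost
    by ONE. *)

Set Implicit Arguments.
Unset Strict Implicit.
Unset Printing Implicit Defensive.

Local Open Scope classical_set_scope.

(** * Finitely many exceptions *)

Lemma near_finite_set (T I : Type) (F : set_system T) (D : set I)
    (P : I -> T -> Prop) :
  Filter F -> finite_set D ->
  (forall i, D i -> \forall x \near F, P i x) ->
  \forall x \near F, forall i, D i -> P i x.
Proof.
move=> FF; elim/Pchoice: I => I in D P *.
move=> /finite_fsetP[E ->] FP.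
apply: filterS (@filter_bigI T I E P F FF _) => [x + i iE|i iE]; last exact: FP.
exact.
Qed.

Lemma injective_near_geq (g : nat -> nat) (N : nat) :
  injective g -> \forall k \near \oo, (N <= g k)%N.
Proof.
move=> g_inj.
have g_neq (j : 'I_N) : \forall k \near \oo, g k <> j.
  have [[k0 gk0]|no_k] := pselect (exists k, g k = j).
    exists k0.+1 => // k /= k0k gk; move: k0k.
    by rewrite (g_inj k k0) ?ltnn // gk gk0.
  by exists 0%N => // k _ gk; apply: no_k; exists k.
apply: filterS (filter_forall _ g_neq) => k gk.
by rewrite leqNgt; apply/negP => ltgN; apply: (gk (Ordinal ltgN)).
Qed.

(** * Gamma sequences *)

Definition gamma_seq (X : topologicalType) (B : set (set X))
    (U : nat -> set X) : Prop :=
  [/\ forall n, open (U n), forall n, U n <> setT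
    & forall A, B A -> \forall n \near \oo, A `<=` U n].

Section GammaSequences.
Context {X : topologicalType} {B : set (set X)}.
Hypothesis hB : bornology B.

Lemma bornology_set1 (x : X) : B [set x].
Proof.
case: hB => subB _ covB _.
have [A BA Ax] : (\bigcup_(A in B) A) x by rewrite covB.
by apply: subB BA => _ ->.
Qed.

(** A point outside [W] is a bounded set, hence lies in almost all terms. *)
Lemma gamma_seq_near_neq (U : nat -> set X) (W : set X) :
  gamma_seq B U -> W <> setT -> \forall n \near \oo, U n <> W.
Proof.
move=> [_ _ Ulim] /eqP/setTPn[x Wx].
apply: filterS (Ulim _ (bornology_set1 x)) => n xU UnW.
by apply: Wx; rewrite -UnW; apply: xU.
Qed.

Lemma gamma_seq_near_notin (U : nat -> set X) (D : set (set X)) :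
  gamma_seq B U -> finite_set D -> ~ D setT -> \forall n \near \oo, ~ D (U n).
Proof.
move=> gU finD DT.
have : \forall n \near \oo, forall W, D W -> U n <> W.
  apply: near_finite_set => // W DW; apply: gamma_seq_near_neq => // WT.
  by apply: DT; rewrite -WT.
by apply: filterS => n UD DU; apply: UD DU _.
Qed.

Lemma gamma_seq_infinite (U : nat -> set X) :
  gamma_seq B U -> infinite_set (range U).
Proof.
move=> gU finU; have [_ UT _] := gU.
have [|n] := filter_ex (gamma_seq_near_notin gU finU _).
  by case=> n _ /UT.
by apply; exists n.
Qed.

Lemma gamma_coversP (W : set (set X)) :
  gamma_covers B W <-> exists2 U, gamma_seq B U & W = range U.
Proof.
split=> [[U [-> _ _ Uop Ulim]]|[U gU ->]].
  exists U => //; split=> [n|n|A /Ulim[n0 AU]]; [by case: (Uop n)..|].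
  by exists n0.
have infU := gamma_seq_infinite gU; case: gU => Uop UT Ulim.
exists U; split=> // [|A /Ulim[n0 _ AU]]; last by exists n0.
apply/seteqP; split=> // x _.
have [n xU] := filter_ex (Ulim _ (bornology_set1 x)).
by exists n => //; apply: xU.
Qed.

(** The diagonal meets used to pass from a selection at a late round back to
    selections at all the earlier rounds. *)
Lemma gamma_seq_meet (U : nat -> nat -> set X) (k : nat) :
  (forall i, gamma_seq B (U i)) ->
  gamma_seq B (fun m => [set x | forall i : 'I_k.+1, U i m x]).
Proof.
move=> gU; split=> [m|m|A BA].
- rewrite openE => x Ux; apply: filter_forall => i.
  by apply: open_nbhs_nbhs; split; [case: (gU i)|apply: Ux].
- case: (gU 0%N) => _ U0T _ UT; apply: (U0T m); rewrite -subTset -UT.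
  by move=> x /(_ ord0).
- have AU (i : 'I_k.+1) : \forall m \near \oo, A `<=` U i m.
    by case: (gU i) => _ _; apply.
  by apply: filterS (filter_forall _ AU) => m AUm x Ax i; apply: AUm.
Qed.

(** If the selection enumerates a gamma cover in the wrong order, terms [V n]
    can be reassigned to rounds [j] with [j <= n], in such a way that they
    occur at arbitrarily late places of the correct enumeration. *)
Lemma gamma_seq_reorder (U V : nat -> set X) :
  gamma_seq B U -> range V = range U ->
  exists n : nat -> nat, (forall j, j <= n j)%N /\
    forall A, B A -> \forall j \near \oo, A `<=` V (n j).
Proof.
move=> gU VU; have [_ UT Ulim] := gU.
have late j : exists n, (j <= n)%N /\ exists2 p, (j <= p)%N & V n = U p.
  (* A late term of [U] avoiding [V 0], ..., [V j.-1] is some [V n], n >= j. *)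
  have finV : finite_set (V @` `I_j) by apply: finite_image; apply: finite_II.
  have VT : ~ (V @` `I_j) setT.
    case=> n _ VnT; have : range U setT by rewrite -VU; exists n.
    by case=> p _ /UT.
  have [p [/= jp VUp]] :=
    filter_ex (filterI (nbhs_infty_ge j) (gamma_seq_near_notin gU finV VT)).
  have : range V (U p) by rewrite VU; exists p.
  case=> n _ VnU; exists n; split; last by exists p.
  by rewrite leqNgt; apply/negP => nj; apply: VUp; exists n.
have [n nP] := choice late.
exists n; split=> [j|A /Ulim[N _ AU]]; first by case: (nP j).
exists N => // j /= Nj; have [_ [p jp ->]] := nP j.
by apply: AU; apply: leq_trans jp.
Qed.

(** S1 is applied to the meets of the sequences [U 0], ..., [U k]: a selection
    made at a round [n j >= j] is contained in the corresponding term of [U j]. *)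
Lemma gamma_selection (U : nat -> nat -> set X) :
  S1 (gamma_covers B) (gamma_covers B) -> (forall i, gamma_seq B (U i)) ->
  exists m : nat -> nat, gamma_seq B (fun i => U i (m i)).
Proof.
move=> S1B gU.
pose M k m := [set x | forall i : 'I_k.+1, U i m x].
have [k|V [VM /gamma_coversP[W gW VW]]] := S1B (fun k => range (M k)).
  by apply/gamma_coversP; exists (M k) => //; apply: gamma_seq_meet.
have VM_term k : exists m, M k m = V k by have [m _ <-] := VM k; exists m.
have [l lP] := choice VM_term.
have [n [n_ge Vlim]] := gamma_seq_reorder gW VW.
exists (fun j => l (n j)); split=> [j|j|A /Vlim]; [by case: (gU j)..|].
apply: filterS => j AV x /AV; rewrite -lP => Mx.
exact: (Mx (Ordinal (n_ge j : j < (n j).+1)%N)).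
Qed.

End GammaSequences.

(** * Plays against a strategy *)

Lemma legal_position_rcons (T : Type) (sigma : seq T -> set T) (s : seq T)
    (x : T) :
  legal_position sigma s -> sigma s x -> legal_position sigma (rcons s x).
Proof.
move=> legal sx x0 i; rewrite size_rcons ltnS leq_eqVlt => /orP[/eqP ->|lt_i].
  by rewrite nth_rcons ltnn eqxx -cats1 take_size_cat.
by rewrite nth_rcons lt_i -cats1 takel_cat ?(ltnW lt_i) //; apply: legal.
Qed.

(** The position reached when TWO chooses the terms numbered by a list of
    naturals, [e s] being the enumeration of ONE's move at position [s]. *)
Definition position (T : Type) (e : seq T -> nat -> T) (t : seq nat) : seq T :=
  foldl (fun s n => rcons s (e s n)) [::] t.

Lemma position_rcons (T : Type) (e : seq T -> nat -> T) (t : seq nat) (n : nat) :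
  position e (rcons t n) = rcons (position e t) (e (position e t) n).
Proof. exact: foldl_rcons. Qed.

Lemma legal_position_position (T : Type) (sigma : seq T -> set T)
    (e : seq T -> nat -> T) (t : seq nat) :
  (forall s n, legal_position sigma s -> sigma s (e s n)) ->
  legal_position sigma (position e t).
Proof.
move=> e_legal; elim/last_ind: t => [|t n IHt]; first by [].
by rewrite position_rcons; apply: legal_position_rcons => //; apply: e_legal.
Qed.

Fixpoint branch (f : seq nat -> nat) (k : nat) : seq nat :=
  if k is k'.+1 then rcons (branch f k') (f (branch f k')) else [::].

Lemma size_branch (f : seq nat -> nat) (k : nat) : size (branch f k) = k.
Proof. by elim: k => //= k IHk; rewrite size_rcons IHk. Qed.

Lemma position_branch (T : Type) (e : seq T -> nat -> T) (f : seq nat -> nat)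
    (k : nat) :
  position e (branch f k) =
  mkseq (fun i => e (position e (branch f i)) (f (branch f i))) k.
Proof. by elim: k => //= k IHk; rewrite position_rcons mkseqS -IHk. Qed.

(** TWO answers with one simultaneous selection over all positions.  Positions
    along a play have distinct lengths, hence distinct codes, so each of the
    finitely many exceptions to containing a bounded set occurs at most once. *)
Lemma strategy_ONE_loses (X : topologicalType) (B : set (set X))
    (sigma : seq (set X) -> set (set X)) :
  bornology B -> S1 (gamma_covers B) (gamma_covers B) ->
  strategy_ONE (gamma_covers B) sigma -> ~ winning_ONE (gamma_covers B) sigma.
Proof.
move=> hB S1B sigma_covers sigma_wins.
have enum s : exists U, legal_position sigma s ->
    gamma_seq B U /\ sigma s = range U.
  have [legal|illegal] := pselect (legal_position sigma s).
    have /(gamma_coversP hB)[U gU sU] := sigma_covers s legal.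
    by exists U.
  by exists (fun=> set0) => /illegal.
have [e eP] := choice enum.
have e_legal s n : legal_position sigma s -> sigma s (e s n).
  by move=> /eP[_ ->]; exists n.
have pos_legal t : legal_position sigma (position e t).
  exact: legal_position_position.
(* The numbers that code no list of naturals are sent to the initial position. *)
pose decode n : seq nat := odflt [::] (unpickle n).
have [n|m gm] := @gamma_selection _ _ hB (fun n => e (position e (decode n))) S1B.
  by case: (eP _ (pos_legal (decode n))).
pose f (t : seq nat) := m (pickle t).
pose V k := e (position e (branch f k)) (f (branch f k)).
apply: (sigma_wins V) => [k|].
  by rewrite /V -position_branch; apply: e_legal.
apply/(gamma_coversP hB); exists V => //.
have VE k : V k = (fun n => e (position e (decode n)) (m n)) (pickle (branch f k)).
  by rewrite /V /decode pickleK.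
have [mop mT mlim] := gm; split=> [k|k|A /mlim[N _ AU]].
- by rewrite VE; apply: mop.
- by rewrite VE; apply: mT.
- have code_inj : injective (fun k => pickle (branch f k)).
    move=> j k /(pcan_inj pickleK) /(congr1 size).
    by rewrite !size_branch.
  apply: filterS (injective_near_geq N code_inj) => k Nk.
  by rewrite VE; apply: AU.
Qed.

Theorem theorem3p18 (X : topologicalType) (B : set (set X)) (hB : bornology B) :
  S1 (gamma_covers B) (gamma_covers B) <->
  ~ ONE_has_winning_strategy_G1 (gamma_covers B) (gamma_covers B).
Proof.
split=> [S1B [sigma [sigma_covers]]|noWin U Ucovers].
  exact: strategy_ONE_loses.
apply: contrapT => noV; apply: noWin; exists (fun s => U (size s)).
split=> [s _|V VU VB]; first exact: Ucovers.
apply: noV; exists V; split=> // n.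
by have := VU n; rewrite size_mkseq.
Qed.
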